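(* Let $A,N\in\mathbb{R}^{n\times n}$ be such that $$\sigma(I\otimes A+A\otimes I+N\otimes N)\subset\mathbb{C}_-.$$ Assume further that for a block-diagonal matrix $\Sigma=\operatorname{diag}(\Sigma_1,\Sigma_2)>0$ with $\sigma(\Sigma_1)\cap\sigma(\Sigma_2)=\emptyset$ we have $$A^T\Sigma+\Sigma A+N^T\Sigma N\le 0\quad\text{and}\quad A^T\Sigma^{-1}+\Sigma^{-1}A+N^T\Sigma^{-1}N\le 0.$$ Partition $$A=\begin{bmatrix} A_{11} & A_{12} \\ A_{21} & A_{22} \end{bmatrix},\qquad N=\begin{bmatrix} N_{11} & N_{12} \\ N_{21} & N_{22} \end{bmatrix}$$ conformally with $\Sigma=\operatorname{diag}(\Sigma_1,\Sigma_2)$. Then $$\sigma(I\otimes A_{11}+A_{11}\otimes I+N_{11}\otimes N_{11})\subset\mathbb{C}_-.$$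
   Context: Here $\sigma(\cdot)$ denotes the spectrum of a square matrix, $\mathbb{C}_-$ the open left half complex plane, $\otimes$ the Kronecker product, and $I$ an identity matrix of the appropriate size. For real symmetric matrices, $X>0$ means positive definite, and $X\le Y$ means that $Y-X$ is positive semidefinite; in particular $\Sigma>0$ means that $\Sigma$ is real symmetric positive definite. The block $\Sigma_1$ is square, and $A_{11},N_{11}$ have the same size as $\Sigma_1$. *)

(* Defs.v *)
From mathcomp Require Export all_boot all_order all_algebra.
From mathcomp Require Export reals.
From mathcomp.real_closed Require Export complex mxtens.

Set Implicit Arguments.
Unset Strict Implicit.
Unset Printing Implicit Defensive.

Import Order.TTheory GRing.Theory Num.Theory.
Local Open Scope ring_scope.

Definition spectrum (R : realType) (n : nat) (M : 'M[R]_n) : pred R[i] :=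
  eigenvalue (map_mx (real_complex R) M).

Definition open_left_half_plane (R : realType) : pred R[i] :=
  fun z => complex.Re z < 0.
Arguments open_left_half_plane : clear implicits.

Definition possemidefmx (R : realType) (n : nat) (M : 'M[R]_n) : Prop :=
  M^T = M /\ forall x : 'cV[R]_n, 0 <= (x^T *m M *m x) 0 0.

Definition posdefmx (R : realType) (n : nat) (M : 'M[R]_n) : Prop :=
  M^T = M /\ forall x : 'cV[R]_n, x != 0 -> 0 < (x^T *m M *m x) 0 0.

Definition lemx (R : realType) (n : nat) (X Y : 'M[R]_n) : Prop :=
  possemidefmx (Y - X).

(* [*t] is the Kronecker product of matrices. *)
Definition kron_lyapunov (R : realType) (n : nat) (A N : 'M[R]_n)
    : 'M[R]_(n * n) :=
  (1%:M : 'M[R]_n) *t A + A *t (1%:M : 'M[R]_n) + N *t N.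

(* Main.v *)
Require Import Defs.
From HB Require Import structures.
From mathcomp Require Import all_boot all_order all_algebra reals.
From mathcomp Require Import boolp spectral sesquilinear ring ssrAC.
From mathcomp.real_closed Require Import complex mxtens.

Set Implicit Arguments.
Unset Strict Implicit.
Unset Printing Implicit Defensive.

Import Order.TTheory GRing.Theory Num.Theory.
Local Open Scope ring_scope.

(** The proof is by contraposition, over the complex numbers.  Matrices act on
    row vectors, and [lyap B D X] is [B X + X B^H + D X D^H];
    with [B = A^T] and [D = N^T] it is the operator
    [X |-> A^T X + X A + N^T X N], whose eigenvalues are those of
    [kron_lyapunov A N] ([mem_spectrum_kron]).

    Write [B11], [D11], [X = Sigma1] for the truncated data and suppose that
    [lyap B11 D11] has an eigenvalue of nonnegative real part.  An invariant
    subspace of [B11] and [D11] is encoded by a full row rank [U] with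
    [U B11 = b U] and [U D11 = d U].

    - If [H] is positive semidefinite and [lyap B D H] is negative
      semidefinite, then the kernel of [H] is invariant under [B] and [D] and
      is killed by [lyap B D H] ([ker_lyap]).  Applied to block-diagonal
      matrices and to [H = [[m X, Y], [Y^H, m X]]], where [Y] is the eigenvector and [m] is the
      least number that makes [H] semidefinite, this gives an invariant
      subspace on which [lyap B11 D11 X] vanishes ([ex_null_intertwiner]).
    - Take such a subspace of least dimension.  Then [b] and [d] have no common
      invariant subspace, and the same lemma on kernels shows that
      [lyap b d Q = 0] as soon as [lyap b d Q] is semidefinite
      ([irreducible_lyap]).
    - This rigidity and the inequality for the inverse of [X] show that the set
      of all [V] with [V B11 = b V] and [V D11 = d V] is stable under
      multiplication by [X^2] ([intertwiner_mul_sqr]).  Hence it contains an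
      eigenvector of that multiplication, that is some [V] of full rank with
      [V X = s V] ([ex_eigen_intertwiner]).
    - Let [B12], [D12] be the upper right blocks of [B], [D], and [Z = Sigma2].
      The two inequalities for the full system give [V D12 = 0] and
      [V B12 Z^2 = s^2 V B12] ([lyap_offdiag]), so that [V B12 = 0] since [s]
      is not an eigenvalue of [Z].  Thus [V], extended by zero, intertwines the
      full matrices with [b] and [d].  As [lyap b d] is singular, so is
      [lyap B D] ([lyap_singular]), and [0] is an eigenvalue of
      [kron_lyapunov A N], which contradicts stability. *)

(** * Hermitian forms on row vectors *)

Definition adjmx (C : numClosedFieldType) m n (M : 'M[C]_(m, n)) : 'M[C]_(n, m) :=
  map_mx Num.conj M^T.
Local Notation "M ^H" := (adjmx M) (at level 8, format "M ^H").

Section Hermitian.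
Variable C : numClosedFieldType.

Lemma adjmxK m n (M : 'M[C]_(m, n)) : M^H^H = M.
Proof. by apply/matrixP=> i j; rewrite !mxE conjCK. Qed.

Lemma adjmxM m n p (M : 'M[C]_(m, n)) (P : 'M[C]_(n, p)) :
  (M *m P)^H = P^H *m M^H.
Proof. by rewrite /adjmx trmx_mul map_mxM. Qed.

Lemma adjmxD m n (M P : 'M[C]_(m, n)) : (M + P)^H = M^H + P^H.
Proof. by apply/matrixP=> i j; rewrite !mxE rmorphD. Qed.

Lemma adjmxN m n (M : 'M[C]_(m, n)) : (- M)^H = - M^H.
Proof. by apply/matrixP=> i j; rewrite !mxE rmorphN. Qed.

Lemma adjmxB m n (M P : 'M[C]_(m, n)) : (M - P)^H = M^H - P^H.
Proof. by rewrite adjmxD adjmxN. Qed.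

Lemma adjmxZ m n a (M : 'M[C]_(m, n)) : (a *: M)^H = a^* *: M^H.
Proof. by apply/matrixP=> i j; rewrite !mxE rmorphM. Qed.

Lemma adjmx0 m n : (0 : 'M[C]_(m, n))^H = 0.
Proof. by apply/matrixP=> i j; rewrite !mxE rmorph0. Qed.

Lemma adjmx_scalar n a : (a%:M : 'M[C]_n)^H = a^*%:M.
Proof. by apply/matrixP=> i j; rewrite !mxE eq_sym rmorphMn. Qed.

Lemma adjmx_row m n1 n2 (M : 'M[C]_(m, n1)) (P : 'M[C]_(m, n2)) :
  (row_mx M P)^H = col_mx M^H P^H.
Proof. by rewrite /adjmx tr_row_mx map_col_mx. Qed.

Lemma adjmx_block m1 m2 n1 n2 (a : 'M[C]_(m1, n1)) (b : 'M[C]_(m1, n2))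
    (c : 'M[C]_(m2, n1)) (d : 'M[C]_(m2, n2)) :
  (block_mx a b c d)^H = block_mx a^H c^H b^H d^H.
Proof. by rewrite /adjmx tr_block_mx map_block_mx. Qed.

Definition qform n (X : 'M[C]_n) (u : 'rV[C]_n) : C := (u *m X *m u^H) 0 0.

Definition psd n (X : 'M[C]_n) := X^H = X /\ forall u, 0 <= qform X u.

Definition pd n (X : 'M[C]_n) := X^H = X /\ forall u, u != 0 -> 0 < qform X u.

Lemma qform_congr m n (V : 'M[C]_(m, n)) X u :
  qform (V *m X *m V^H) u = qform X (u *m V).
Proof. by rewrite /qform adjmxM !mulmxA. Qed.

Lemma qformN n (X : 'M[C]_n) u : qform (- X) u = - qform X u.
Proof. by rewrite /qform mulmxN mulNmx mxE. Qed.

Lemma qformD n (X Y : 'M[C]_n) u : qform (X + Y) u = qform X u + qform Y u.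
Proof. by rewrite /qform mulmxDr mulmxDl mxE. Qed.

Lemma qformZ n a (X : 'M[C]_n) u : qform (a *: X) u = a * qform X u.
Proof. by rewrite /qform -scalemxAr -scalemxAl mxE. Qed.

Lemma psdD n (X Y : 'M[C]_n) : psd X -> psd Y -> psd (X + Y).
Proof.
move=> [hX pX] [hY pY]; split; first by rewrite adjmxD hX hY.
by move=> u; rewrite qformD addr_ge0.
Qed.

Lemma psdZ n a (X : 'M[C]_n) : 0 <= a -> psd X -> psd (a *: X).
Proof.
move=> a_ge0 [hX pX]; split; first by rewrite adjmxZ hX geC0_conj.
by move=> u; rewrite qformZ mulr_ge0.
Qed.

Lemma pd_psd n (X : 'M[C]_n) : pd X -> psd X.
Proof.
case=> hX pX; split=> // u; have [->|/pX/ltW//] := eqVneq u 0.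
by rewrite /qform !mul0mx mxE.
Qed.

Lemma psd_congr m n (V : 'M[C]_(m, n)) X : psd X -> psd (V *m X *m V^H).
Proof.
case=> hX pX; split; first by rewrite !adjmxM adjmxK hX mulmxA.
by move=> u; rewrite qform_congr.
Qed.

Lemma qform1_eq0 n (v : 'rV[C]_n) : (v *m v^H) 0 0 = 0 -> v = 0.
Proof.
rewrite mxE => /eqP; rewrite psumr_eq0 => [/allP v0|i _]; last first.
  by rewrite !mxE mul_conjC_ge0.
apply/rowP => i; rewrite mxE; have /= := v0 i; rewrite mem_index_enum.
by move=> /(_ isT); rewrite !mxE mul_conjC_eq0 => /eqP.
Qed.

Lemma qform1_ge0 n (v : 'rV[C]_n) : 0 <= (v *m v^H) 0 0.
Proof. by rewrite mxE sumr_ge0 // => i _; rewrite !mxE mul_conjC_ge0. Qed.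

(** If [v = u X] were nonzero, the form of [X] would be negative at [u - e v]
    for small [e > 0]. *)
Lemma psd_qform0 n (X : 'M[C]_n) u : psd X -> qform X u = 0 -> u *m X = 0.
Proof.
case=> hX pX u0; set v := u *m X; apply: qform1_eq0.
set q := (v *m v^H) 0 0; have q_ge0 : 0 <= q by apply: qform1_ge0.
set c := qform X v; have c_ge0 : 0 <= c := pX v.
(* With this choice [e c <= q], so that the form at [u - e v], which is
   [- 2 e q + e^2 c], is at most [- e q]. *)
set e := q / (c + 1).
have e_ge0 : 0 <= e by rewrite divr_ge0 ?addr_ge0.
have qformE : qform X (u - e *: v) = - (e * q + e * q) + e * e * c.
  have vE : X *m u^H = v^H by rewrite adjmxM hX.
  have eC : e^* = e by rewrite geC0_conj.
  rewrite /qform adjmxB adjmxZ eC mulmxBl -scalemxAl -/v mulmxBl !mulmxBr.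
  rewrite -!scalemxAl -!scalemxAr.
  have -> : v *m u^H = u *m X *m u^H by [].
  have -> : u *m X *m v^H = v *m v^H by [].
  have -> : v *m X *m u^H = v *m v^H by rewrite -mulmxA vE.
  have entryB (M P : 'M[C]_1) : (M - P) 0 0 = M 0 0 - P 0 0 by rewrite !mxE.
  have entryZ k (M : 'M[C]_1) : (k *: M) 0 0 = k * M 0 0 by rewrite mxE.
  rewrite !(entryB, entryZ) -[(u *m X *m u^H) 0 0]/(qform X u) u0 -/q.
  by rewrite -[(v *m X *m v^H) 0 0]/c; ring.
have := pX (u - e *: v); rewrite qformE.
have c1_gt0 : 0 < c + 1 by rewrite ltr_wpDl.
have -> : - (e * q + e * q) + e * e * c = - (e * (q + e)).
  by rewrite /e; field; rewrite gt_eqF.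
rewrite oppr_ge0 => le0.
have /eqP : e * (q + e) = 0 by apply/le_anti; rewrite le0 mulr_ge0 ?addr_ge0.
rewrite mulf_eq0 /e paddr_eq0 // mulf_eq0 invr_eq0 (gt_eqF c1_gt0) orbF.
by case/orP=> [/eqP //|/andP[/eqP //]].
Qed.

Lemma qform_mulmx_row m n (V : 'M[C]_(m, n)) X i :
  qform X (row i V) = (V *m X *m V^H) i i.
Proof.
rewrite /qform -row_mul !mxE; apply: eq_bigr => k _; rewrite !mxE.
by congr (_ * _); apply: eq_bigr => l _; rewrite !mxE.
Qed.

Lemma psd_congr0 m n (V : 'M[C]_(m, n)) X :
  psd X -> V *m X *m V^H = 0 -> V *m X = 0.
Proof.
move=> pX V0; apply/row_matrixP => i; rewrite row_mul row0.
by apply: psd_qform0 => //; rewrite qform_mulmx_row V0 mxE.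
Qed.

Lemma psdN_congr m n (V : 'M[C]_(m, n)) X :
  psd (- X) -> psd (- (V *m X *m V^H)).
Proof. by move=> nX; rewrite -mulNmx -mulmxN; apply: psd_congr. Qed.

Lemma psdN_congr0 m n (V : 'M[C]_(m, n)) X :
  psd (- X) -> V *m X *m V^H = 0 -> V *m X = 0.
Proof.
move=> nX V0; apply/eqP; rewrite -oppr_eq0 -mulmxN; apply/eqP.
by apply: psd_congr0 nX _; rewrite mulmxN mulNmx V0 oppr0.
Qed.

Lemma psd_anti n (X : 'M[C]_n) : psd X -> psd (- X) -> X = 0.
Proof.
move=> pX [_ nX]; rewrite -[LHS]mul1mx; apply/row_matrixP => i.
rewrite row_mul row0; apply: psd_qform0 => //; apply/le_anti.
by rewrite -oppr_ge0 -qformN nX pX.2.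
Qed.

Lemma pd1 n : pd (1%:M : 'M[C]_n).
Proof.
split; first by rewrite adjmx_scalar conjC1.
move=> u u0; rewrite lt_neqAle /qform mulmx1 qform1_ge0 andbT eq_sym.
by apply: contra u0 => /eqP/qform1_eq0 ->.
Qed.

Lemma pd_congr0 m n (V : 'M[C]_(m, n)) X :
  pd X -> V *m X *m V^H = 0 -> V = 0.
Proof.
move=> [_ pX] V0; apply/row_matrixP => i; rewrite row0.
apply/eqP/negP => /negP/pX.
by rewrite qform_mulmx_row V0 mxE ltxx.
Qed.

Lemma pd_unit n (X : 'M[C]_n) : pd X -> X \in unitmx.
Proof.
move=> pX; rewrite -row_free_unit -kermx_eq0; apply/eqP.
by apply: (pd_congr0 pX); rewrite mulmx_ker mul0mx.
Qed.

Lemma pd_inv n (X : 'M[C]_n) : pd X -> pd (invmx X).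
Proof.
move=> pX; have uX := pd_unit pX; have hX := pX.1.
have hXi : (invmx X)^H = invmx X.
  have XiX : (invmx X)^H *m X = 1%:M.
    by rewrite -[X in _ *m X]hX -adjmxM mulmxV // adjmx_scalar rmorph1.
  by rewrite -[LHS](mulmxK uX) XiX mul1mx.
split=> // u u0.
have -> : qform (invmx X) u = qform X (u *m invmx X).
  by rewrite -qform_congr hXi mulVmx ?mul1mx.
apply: pX.2; apply: contra u0 => /eqP e.
by rewrite -[u](mulmxKV uX) e mul0mx.
Qed.

Lemma pd_congr m n (V : 'M[C]_(m, n)) X :
  row_free V -> pd X -> pd (V *m X *m V^H).
Proof.
move=> fV pX; split; first by rewrite !adjmxM adjmxK pX.1 mulmxA.
move=> u u0; rewrite qform_congr; apply: pX.2.
by rewrite mulmx_free_eq0.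
Qed.

(** The row [u = nz_row V] satisfies [u X^2 = t u], hence [t > 0]; then
    [X^2 - t = (X - s) (X + s)] with [s = sqrtC t], and [X + s] is
    invertible. *)
Lemma pd_sqr_eigen m n (X : 'M[C]_n) (V : 'M[C]_(m, n)) t :
  pd X -> V != 0 -> V *m X *m X = t *: V -> 0 < t /\ V *m X = sqrtC t *: V.
Proof.
move=> pX V0 VXX; have [hX posX] := pX.
have t_gt0 : 0 < t.
  set u := nz_row V; have u0 : u != 0 by rewrite nz_row_eq0.
  have uXX : u *m X *m X = t *: u.
    have /submxP[w uE] := nz_row_sub V.
    by rewrite /u uE -2!(mulmxA w) VXX scalemxAr.
  have uX0 : u *m X != 0.
    by rewrite mulmx_free_eq0 // row_free_unit pd_unit.
  have := (pd1 n).2 _ uX0; have := (pd1 n).2 _ u0.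
  rewrite /qform !mulmx1 => qu; rewrite adjmxM hX mulmxA uXX -scalemxAl mxE.
  by rewrite pmulr_lgt0.
split=> //; set s := sqrtC t; have s_gt0 : 0 < s by rewrite sqrtC_gt0.
have pXs : pd (X + s%:M).
  split; first by rewrite adjmxD adjmx_scalar hX geC0_conj // ltW.
  move=> u u0; rewrite qformD ltr_wpDr ?posX // /qform mul_mx_scalar.
  by rewrite -scalemxAl mxE mulr_ge0 ?qform1_ge0 // ltW.
apply/eqP; rewrite -subr_eq0; apply/eqP.
rewrite -[LHS](mulmxK (pd_unit pXs)); set W := (_ *m (X + _)).
suff -> : W = 0 by rewrite mul0mx.
rewrite /W mulmxDr !mulmxBl VXX !mul_mx_scalar -scalemxAl scalerA.
by rewrite -expr2 sqrtCK addrA subrK subrr.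
Qed.

Lemma qform_block m n (X : 'M[C]_m) (Z : 'M[C]_n) u v :
  qform (block_mx X 0 0 Z) (row_mx u v) = qform X u + qform Z v.
Proof.
rewrite /qform adjmx_row mul_row_block !mulmx0 addr0 add0r mul_row_col.
by rewrite mxE.
Qed.

Lemma psd_block m n (X : 'M[C]_m) (Z : 'M[C]_n) :
  psd X -> psd Z -> psd (block_mx X 0 0 Z).
Proof.
move=> [hX pX] [hZ pZ]; split; first by rewrite adjmx_block hX hZ !adjmx0.
by move=> u; rewrite -[u]hsubmxK qform_block addr_ge0.
Qed.

Lemma pd_block m n (X : 'M[C]_m) (Z : 'M[C]_n) :
  pd X -> pd Z -> pd (block_mx X 0 0 Z).
Proof.
move=> pX pZ; split; first by rewrite adjmx_block pX.1 pZ.1 !adjmx0.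
move=> u; rewrite -[u]hsubmxK qform_block => u0.
have [l0|l0] := eqVneq (lsubmx u) 0.
  rewrite ltr_wpDl ?(pd_psd pX).2 // pZ.2 //; apply: contra u0 => /eqP ->.
  by rewrite l0 row_mx0.
by rewrite ltr_pwDl ?(pd_psd pZ).2 // pX.2.
Qed.

Lemma pd_block_inv m n (X : 'M[C]_m) (Z : 'M[C]_n) :
  pd (block_mx X 0 0 Z) -> pd X /\ pd Z.
Proof.
case=> []; rewrite adjmx_block => /eq_block_mx[hX _ _ hZ] pXZ.
split; split=> // u u0.
  have := pXZ (row_mx u 0); rewrite qform_block [qform Z 0]/qform !mul0mx mxE.
  by rewrite addr0; apply; apply: contra u0; rewrite row_mx_eq0 => /andP[].
have := pXZ (row_mx 0 u); rewrite qform_block [qform X 0]/qform !mul0mx mxE.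
by rewrite add0r; apply; apply: contra u0; rewrite row_mx_eq0 => /andP[].
Qed.

Lemma hermitian_diag n (M : 'M[C]_n) : M^H = M ->
  exists (P : 'M[C]_n) (e : 'rV[C]_n),
    [/\ P \in unitmx, e \is a mxOver Num.real, P *m P^H = 1%:M
      & P *m M *m P^H = diag_mx e].
Proof.
move=> hM; have hh : M \is hermsymmx.
  by apply/is_hermitianmxP; rewrite expr0 scale1r -[LHS]hM.
have /orthomx_spectralP ME := hermitian_normalmx hh.
exists (spectralmx M), (spectral_diag M); split.
- exact: spectral_unit.
- exact: hermitian_spectral_diag_real.
- by apply/unitarymxP; apply: spectral_unitarymx.
- rewrite {2}ME !mulmxA mulmxV ?spectral_unit // mul1mx -mulmxA.
  rewrite -[adjmx _]/((spectralmx M)^t*)%sesqui.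
  rewrite -invmx_unitary ?spectral_unitarymx //.
  by rewrite mulmxV ?spectral_unit // mulmx1.
Qed.

(** Scaling a unitary diagonalization of [S] turns [S] into the identity; a
    unitary diagonalization of the transformed [Q] keeps it so. *)
Lemma simultaneous_diag n (S Q : 'M[C]_n) : pd S -> Q^H = Q ->
  exists (Z : 'M[C]_n) (e : 'rV[C]_n),
    [/\ Z \in unitmx, e \is a mxOver Num.real, Z *m S *m Z^H = 1%:M
      & Z *m Q *m Z^H = diag_mx e].
Proof.
move=> pS hQ; have [P [s [uP rs _ PS]]] := hermitian_diag pS.1.
have s_gt0 i : 0 < s 0 i.
  have -> : s 0 i = qform S (row i P).
    by rewrite qform_mulmx_row PS !mxE eqxx mulr1n.
  apply: pS.2; apply/negP => /eqP r0.
  have : row i (1%:M : 'M[C]_n) = 0 by rewrite -(mulmxV uP) row_mul r0 mul0mx.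
  by move/rowP/(_ i)/eqP; rewrite !mxE eqxx oner_eq0.
pose t : 'rV[C]_n := \row_i (sqrtC (s 0 i))^-1.
have t_gt0 i : 0 < t 0 i by rewrite mxE invr_gt0 sqrtC_gt0.
have tH : (diag_mx t)^H = diag_mx t.
  apply/matrixP=> i j; rewrite !mxE eq_sym; case: eqP => [->|_]; last first.
    by rewrite rmorph0.
  by rewrite !mulr1n geC0_conj // ltW // invr_gt0 sqrtC_gt0.
have uW : diag_mx t *m P \in unitmx.
  rewrite unitmx_mul uP andbT unitmxE det_diag unitfE.
  by apply/prodf_neq0 => i _; rewrite gt_eqF.
have WS : diag_mx t *m P *m S *m (diag_mx t *m P)^H = 1%:M.
  rewrite adjmxM tH !mulmxA -(mulmxA _ P) -(mulmxA (diag_mx t)) PS.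
  rewrite !mulmx_diag; apply/matrixP=> i j; rewrite !mxE; congr (_ *+ _).
  rewrite mulrAC -expr2 exprVn sqrtCK mulVf // gt_eqF //.
set W := diag_mx t *m P in uW WS *.
have hW : (W *m Q *m W^H)^H = W *m Q *m W^H.
  by rewrite !adjmxM !adjmxK hQ !mulmxA.
have [V [e [uV re VV VQ]]] := hermitian_diag hW.
exists (V *m W), e; split=> //; first by rewrite unitmx_mul uV.
- rewrite adjmxM mulmxA -(mulmxA V) -(mulmxA V) WS mulmx1 //.
- by rewrite -VQ adjmxM !mulmxA.
Qed.

(** The number [m] is the largest generalized eigenvalue of the pencil
    [(Q, S)]. *)
Lemma max_pencil n (S Q : 'M[C]_n) : (0 < n)%N -> pd S -> Q^H = Q ->
  exists m, psd (m *: S - Q) /\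
    exists2 u : 'rV[C]_n, u != 0 & u *m (m *: S - Q) = 0.
Proof.
case: n S Q => // n S Q _ pS hQ.
have [Z [e [uZ re ZS ZQ]]] := simultaneous_diag pS hQ.
have rei i : e 0 i \is Num.real by apply: (mxOverP re).
have [k _ k_max] := @real_arg_maxP _ _ (ord0 : 'I_n.+1) xpredT (e 0) isT
  (fun i _ => rei i).
pose d : 'rV[C]_n.+1 := \row_i (e 0 k - e 0 i).
have ZH : Z *m (e 0 k *: S - Q) *m Z^H = diag_mx d.
  rewrite mulmxBr mulmxBl -scalemxAr -scalemxAl ZS ZQ scalemx1.
  by apply/matrixP=> i j; rewrite !mxE mulrnBl.
have HE : e 0 k *: S - Q = invmx Z *m diag_mx d *m (invmx Z)^H.
  have ZZ : Z^H *m (invmx Z)^H = 1%:M.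
    by rewrite -adjmxM mulVmx // adjmx_scalar rmorph1.
  by rewrite -ZH !mulmxA mulVmx // mul1mx -mulmxA ZZ mulmx1.
exists (e 0 k); split.
  rewrite HE; apply: psd_congr; split=> [|u].
    apply/matrixP=> i j; rewrite !mxE eq_sym; case: eqP => [->|_].
      by rewrite !mulr1n geC0_conj // subr_ge0; apply: k_max.
    by rewrite rmorph0.
  rewrite /qform mul_mx_diag mxE sumr_ge0 // => i _; rewrite !mxE.
  by rewrite mulrAC mulr_ge0 ?mul_conjC_ge0 // subr_ge0; apply: k_max.
exists (row k Z).
  apply/negP => /eqP r0.
  have : row k (1%:M : 'M[C]_n.+1) = 0 by rewrite -(mulmxV uZ) row_mul r0 mul0mx.
  by move/rowP/(_ k)/eqP; rewrite !mxE eqxx oner_eq0.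
rewrite HE !mulmxA -row_mul mulmxV // row1.
suff -> : delta_mx (0 : 'I_1) k *m diag_mx d = 0 by rewrite mul0mx.
rewrite -rowE; apply/rowP=> i; rewrite !mxE.
by case: eqP => [->|]; rewrite ?subrr ?mul0rn.
Qed.

End Hermitian.

(** * Lyapunov operators and invariant subspaces *)

Section Lyapunov.
Variable C : numClosedFieldType.

Definition lyap n (B D X : 'M[C]_n) : 'M[C]_n :=
  B *m X + X *m B^H + D *m X *m D^H.

Lemma lyapZ n (B D : 'M[C]_n) a X : lyap B D (a *: X) = a *: lyap B D X.
Proof. by rewrite /lyap -!scalemxAr -!scalemxAl !scalerDr. Qed.

Lemma lyapN n (B D X : 'M[C]_n) : lyap B D (- X) = - lyap B D X.
Proof. by rewrite -!scaleN1r lyapZ. Qed.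

Lemma lyapD n (B D X Y : 'M[C]_n) :
  lyap B D (X + Y) = lyap B D X + lyap B D Y.
Proof. by rewrite /lyap !(mulmxDr, mulmxDl) (AC (2*2*2) ((1*3*5)*(2*4*6))). Qed.

Lemma lyap_intertwine m n (U : 'M[C]_(m, n)) B D b d X :
  U *m B = b *m U -> U *m D = d *m U ->
  U *m lyap B D X *m U^H = lyap b d (U *m X *m U^H).
Proof.
move=> UB UD.
have BU : B^H *m U^H = U^H *m b^H by rewrite -!adjmxM UB.
have DU : D^H *m U^H = U^H *m d^H by rewrite -!adjmxM UD.
rewrite /lyap !(mulmxDr, mulmxDl) !mulmxA UB UD.
by rewrite -!mulmxA BU DU !mulmxA.
Qed.

(** Since [u H = 0], the form of [lyap B D H] at [u] is that of [H] at [u D];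
    the first is nonpositive and the second nonnegative, so both vanish. *)
Lemma ker_lyap m n (B D H : 'M[C]_n) (u : 'M[C]_(m, n)) :
  psd H -> psd (- lyap B D H) -> u *m H = 0 ->
  [/\ u *m B *m H = 0, u *m D *m H = 0 & u *m lyap B D H = 0].
Proof.
move=> pH nL u0.
have u0' : H *m u^H = 0 by rewrite -[H]pH.1 -adjmxM u0 adjmx0.
have E : u *m lyap B D H *m u^H = (u *m D) *m H *m (u *m D)^H.
  rewrite /lyap !(mulmxDr, mulmxDl) adjmxM !mulmxA u0 !mul0mx addr0.
  by rewrite -(mulmxA _ H) u0' mulmx0 add0r.
have uD0 : (u *m D) *m H *m (u *m D)^H = 0.
  by apply: psd_anti; [apply: psd_congr|rewrite -E; apply: psdN_congr].
have uD := psd_congr0 pH uD0.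
have uL : u *m lyap B D H = 0 by apply: psdN_congr0; rewrite // E.
split=> //; move: uL; rewrite /lyap !mulmxDr !mulmxA u0 mul0mx addr0.
by rewrite uD mul0mx addr0.
Qed.

(** Every invariant subspace is the kernel of some [M]: the pair [b], [d] has no
    invariant subspace other than zero and the whole space. *)
Definition irreducible_pair r (b d : 'M[C]_r) :=
  forall q (M : 'M[C]_(r, q)), M != 0 ->
    kermx M *m b *m M = 0 -> kermx M *m d *m M = 0 -> row_free M.

(** With [m] the largest generalized eigenvalue of [(Q, S)], the matrix
    [H = m S - Q] is semidefinite and singular.  Its kernel is a nonzero
    invariant subspace by [ker_lyap], hence everything: [Q = m S]. *)
Lemma irreducible_lyap r (b d S Q : 'M[C]_r) : irreducible_pair b d ->
  pd S -> lyap b d S = 0 -> Q^H = Q -> psd (lyap b d Q) -> lyap b d Q = 0.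
Proof.
case: r b d S Q => [|r] b d S Q irr pS lS hQ pQ.
  by apply/matrixP => -[].
have [m [pH [u u0 uH]]] := max_pencil (ltn0Sn r) pS hQ.
have lH : lyap b d (m *: S - Q) = - lyap b d Q.
  by rewrite lyapD lyapN lyapZ lS scaler0 add0r.
have nH : psd (- lyap b d (m *: S - Q)) by rewrite lH opprK.
have [H0|H0] := eqVneq (m *: S - Q) 0.
  by rewrite -(subr0_eq H0) lyapZ lS scaler0.
have [kb kd _] := ker_lyap pH nH (mulmx_ker _).
have /row_free_inj fH := irr _ _ H0 kb kd.
by case/negP: u0; apply/eqP/fH; rewrite uH mul0mx.
Qed.

(** An invariant subspace of least dimension inside the row space of [K]; the
    relation [K W = 0] passes to subspaces. *)
Lemma ex_irreducible n (B D W : 'M[C]_n) m (K : 'M[C]_(m, n)) :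
  K != 0 -> (K *m B <= K)%MS -> (K *m D <= K)%MS -> K *m W = 0 ->
  exists r (U : 'M[C]_(r, n)) (b d : 'M[C]_r),
    [/\ (0 < r)%N, row_free U, U *m B = b *m U, U *m D = d *m U
      & U *m W = 0] /\ irreducible_pair b d.
Proof.
have [k] := ubnP (\rank K); elim: k m K => // k IHk m K ltk K0 KB KD KW.
pose U := row_base K; have UK : (U :=: K)%MS := eq_row_base K.
have /submxP[b Ub] : (U *m B <= U)%MS by rewrite !UK (eqmxMr B UK).
have /submxP[d Ud] : (U *m D <= U)%MS by rewrite !UK (eqmxMr D UK).
have fU : row_free U := row_base_free K.
have UW : U *m W = 0.
  have /submxP[E ->] : (U <= K)%MS by rewrite UK.
  by rewrite -mulmxA KW mulmx0.
have [irr|] := EM (irreducible_pair b d).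
  exists (\rank K), U, b, d; split=> //; split=> //.
  by rewrite lt0n mxrank_eq0.
move=> /existsNP[q /existsNP[M]].
move=> /not_implyP[M0 /not_implyP[kb /not_implyP[kd /negP nf]]].
have stable B' b' : U *m B' = b' *m U -> kermx M *m b' *m M = 0 ->
    (kermx M *m U *m B' <= kermx M *m U)%MS.
  move=> UB' /eqP; rewrite -sub_kermx => /submxP[E kE].
  by rewrite -mulmxA UB' mulmxA kE -mulmxA submxMl.
apply: (IHk _ (kermx M *m U)).
- have: (\rank M > 0)%N by rewrite lt0n mxrank_eq0.
  move: ltk; rewrite mxrankMfree // mxrank_ker => ltk M_gt0.
  apply: leq_trans (_ : _ <= \rank K)%N _ => //.
  by rewrite ltn_subrL M_gt0 lt0n mxrank_eq0 K0.
- by rewrite mulmx_free_eq0 // kermx_eq0.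
- exact: stable Ub kb.
- exact: stable Ud kd.
- by rewrite -mulmxA UW mulmx0.
Qed.

(** Multiply [V] by the linear factors of the characteristic polynomial of [Z]
    one after the other; the last nonzero product is an eigenvector. *)
Lemma eigenvector_invariant m n (Z : 'M[C]_n) (P : 'M[C]_(m, n) -> Prop) V :
  (forall V a, P V -> P (V *m Z - a *: V)) -> V != 0 -> P V ->
  exists V' a, [/\ V' != 0, P V' & V' *m Z = a *: V'].
Proof.
case: n Z P V => [|n] Z P V stP V0 PV; first by rewrite [V]thinmx0 eqxx in V0.
have [s sE] := closed_field_poly_normal (char_poly Z).
have /monicP lc := char_poly_monic Z; rewrite lc scale1r in sE.
have: V *m horner_mx Z (\prod_(a <- s) ('X - a%:P)) = 0.
  by rewrite -sE Cayley_Hamilton mulmx0.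
elim: {sE} s V V0 PV => [|a s IHs] V V0 PV.
  by rewrite big_nil rmorph1 mulmx1 => e; rewrite e eqxx in V0.
rewrite big_cons rmorphM rmorphB /= horner_mx_X horner_mx_C mulmxA => sZ.
have VZ : V *m (Z - a%:M) = V *m Z - a *: V by rewrite mulmxBr mul_mx_scalar.
have [e|ne] := eqVneq (V *m (Z - a%:M)) 0; last first.
  by apply: IHs ne _ sZ; rewrite VZ; apply: stP.
by exists V, a; split=> //; apply/eqP; rewrite -subr_eq0 -VZ e.
Qed.

(** The eigenvector enters through the block matrix [H = [[m X, Y], [Y^H, m X]]]
    with [m] least such that [H] is semidefinite.  If the second copy of [B] is
    shifted by [- a^*], the off-diagonal blocks of the Lyapunov operator at [H]
    vanish, while the diagonal ones stay negative semidefinite because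
    [0 <= a + a^*].  The first components of the kernel of [H] form the
    subspace. *)
Lemma ex_null_intertwiner n (B D X Y : 'M[C]_n) a : pd X ->
  psd (- lyap B D X) -> Y != 0 -> 0 <= a + a^* -> lyap B D Y = a *: Y ->
  exists r (U : 'M[C]_(r, n)) (b d : 'M[C]_r),
    [/\ (0 < r)%N, row_free U, U *m B = b *m U, U *m D = d *m U
      & U *m lyap B D X = 0] /\ irreducible_pair b d.
Proof.
move=> pX nX Y0 a_ge0 LY.
have n_gt0 : (0 < n)%N.
  by case: (n) Y Y0 {LY} => // Y; rewrite [Y]thinmx0 eqxx.
pose S := block_mx X 0 0 X; pose Q := block_mx 0 (- Y) (- Y^H) 0.
have hQ : Q^H = Q by rewrite adjmx_block !adjmxN adjmxK !adjmx0.
have [|m [pH [u u0 uH]]] := max_pencil _ (pd_block pX pX) hQ.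
  by rewrite addn_gt0 n_gt0.
have HE : m *: S - Q = block_mx (m *: X) Y Y^H (m *: X).
  rewrite /S /Q scale_block_mx opp_block_mx add_block_mx !opprK !scaler0.
  by rewrite !oppr0 !addr0 !add0r.
rewrite -/S HE in pH uH; set H := block_mx _ _ _ _ in pH uH.
have m_gt0 : 0 < m.
  pose e : 'M[C]_(n, n + n) := row_mx 1%:M 0.
  have eHe : e *m H *m e^H = m *: X.
    rewrite adjmx_row adjmx0 adjmx_scalar rmorph1 mul_row_block !mul1mx.
    by rewrite !mul0mx !addr0 mul_row_col mulmx0 mulmx1 addr0.
  pose v := nz_row Y; have v0 : v != 0 by rewrite nz_row_eq0.
  have fv := pX.2 v v0.
  have := (psd_congr e pH).2 v; rewrite eHe qformZ pmulr_lge0 // le_eqVlt.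
  case/orP=> // /eqP m0; case/negP: Y0.
  have : e *m H = 0 by apply: psd_congr0 pH _; rewrite eHe -m0 scale0r.
  rewrite mul_row_block !mul1mx !mul0mx !addr0.
  by rewrite -row_mx0 => /eq_row_mx[_ ->].
pose B2 := block_mx B 0 0 (B - a^*%:M); pose D2 := block_mx D 0 0 D.
have LH : lyap B2 D2 H = block_mx (m *: lyap B D X) 0 0
    (m *: lyap B D X - (m * (a + a^*)) *: X).
  rewrite /lyap /B2 /D2 /H !adjmx_block !adjmx0 !mulmx_block.
  rewrite !(mul0mx, mulmx0, addr0, add0r) !add_block_mx.
  have BC : (B - a^*%:M)^H = B^H - a%:M.
    by rewrite adjmxB adjmx_scalar conjCK.
  congr block_mx; rewrite ?BC.
  - by rewrite -!scalemxAr -!scalemxAl -!scalerDr.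
  - rewrite mulmxBr mul_mx_scalar (AC (1*2*1) (1*2*4*3)) /=.
    by rewrite -[X in X - _]/(lyap B D Y) LY subrr.
  - rewrite mulmxBl mul_scalar_mx (AC (2*1*1) (1*3*4*2)) /=.
    have <- : (lyap B D Y)^H = B *m Y^H + Y^H *m B^H + D *m Y^H *m D^H.
      by rewrite /lyap !adjmxD !adjmxM !adjmxK mulmxA [X in X + _]addrC.
    by rewrite LY adjmxZ subrr.
  - rewrite mulmxBl mulmxBr mul_scalar_mx mul_mx_scalar !scalerA.
    have <- : lyap B D (m *: X) = m *: lyap B D X by rewrite lyapZ.
    rewrite [m * _]mulrC mulrDl scalerDl opprD /lyap.
    by rewrite (AC (2*2*1) ((1*3*5)*(4*2))).
have nH : psd (- lyap B2 D2 H).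
  rewrite LH opp_block_mx !oppr0; apply: psd_block.
    by rewrite -scalerN; apply: psdZ => //; apply: ltW.
  rewrite opprB addrC -scalerN; apply: psdD; apply: psdZ => //.
  - exact: ltW.
  - by rewrite mulr_ge0 // ltW.
  - exact: pd_psd.
pose K := kermx H; have KH : K *m H = 0 := mulmx_ker H.
have [KB KD KL] := ker_lyap pH nH KH.
apply: (@ex_irreducible n B D _ _ (lsubmx K)).
- apply: contra u0 => /eqP K0.
  have /submxP[w uw] : (u <= K)%MS by rewrite sub_kermx uH.
  move: KH; rewrite -[K]hsubmxK K0 mul_row_block !mul0mx !add0r.
  rewrite -row_mx0 => /eq_row_mx[_]; rewrite -scalemxAr => /eqP.
  rewrite scaler_eq0 gt_eqF //= => /eqP rX.
  have r0 : rsubmx K = 0 by rewrite -[LHS](mulmxK (pd_unit pX)) rX mul0mx.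
  by rewrite uw -[K]hsubmxK K0 r0 row_mx0 mulmx0.
- move/eqP: KB; rewrite -sub_kermx => /submxP[w] /(congr1 lsubmx).
  rewrite -{1}[K]hsubmxK mul_row_block !mulmx0 addr0 row_mxKl => ->.
  by rewrite -{1}[kermx H]hsubmxK mul_mx_row row_mxKl submxMl.
- move/eqP: KD; rewrite -sub_kermx => /submxP[w] /(congr1 lsubmx).
  rewrite -{1}[K]hsubmxK mul_row_block !mulmx0 addr0 row_mxKl => ->.
  by rewrite -{1}[kermx H]hsubmxK mul_mx_row row_mxKl submxMl.
- move: KL; rewrite LH -{1}[K]hsubmxK mul_row_block !mulmx0 addr0.
  rewrite -row_mx0 => /eq_row_mx[+ _]; rewrite -scalemxAr => /eqP.
  by rewrite scaler_eq0 gt_eqF //= => /eqP.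
Qed.

(** The hypothesis multiplied by [T^H], together with its adjoint, eliminates
    all terms with [b] or [B]. *)
Lemma intertwining_defect m n (T : 'M[C]_(m, n)) B D b d Z : Z^H = Z ->
  b *m (T *m Z) + T *m Z *m B^H + d *m (T *m Z) *m D^H = 0 ->
  (T *m D - d *m T) *m Z *m (T *m D - d *m T)^H =
  lyap b d (T *m Z *m T^H) + T *m lyap B D Z *m T^H.
Proof.
move=> hZ E; have E1 : b *m T *m Z *m T^H + T *m Z *m B^H *m T^H =
    - (d *m T *m Z *m D^H *m T^H).
  by apply/eqP; rewrite -addr_eq0 -!mulmxDl -(mul0mx _ T^H) -E !mulmxA.
have E2 : T *m Z *m T^H *m b^H + T *m B *m Z *m T^H =
    - (T *m D *m Z *m T^H *m d^H).
  have := congr1 (@adjmx C _ _) E1.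
  by rewrite !(adjmxD, adjmxN, adjmxM, adjmxK) hZ !mulmxA.
rewrite /lyap adjmxB !adjmxM.
rewrite !(mulmxDr, mulmxDl, mulmxN, mulNmx, mulmxA, opprD, opprK).
rewrite [RHS](AC (3*3) ((1*5)*(2*4)*3*6)) /= E1 E2.
by rewrite (AC (2*2) (3*2*4*1)).
Qed.

(** By [lyap_intertwine], [lyap b d (V X V^H)] is negative semidefinite, hence
    zero by irreducibility. *)
Lemma irreducible_intertwiner r n (V : 'M[C]_(r, n)) (B D X : 'M[C]_n)
    (b d S : 'M[C]_r) :
  irreducible_pair b d -> pd S -> lyap b d S = 0 ->
  X^H = X -> psd (- lyap B D X) -> V *m B = b *m V -> V *m D = d *m V ->
  lyap b d (V *m X *m V^H) = 0 /\ V *m lyap B D X = 0.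
Proof.
move=> irr pS lS hX nX VB VD.
have lV : lyap b d (V *m X *m V^H) = 0.
  apply/eqP; rewrite -oppr_eq0 -lyapN; apply/eqP.
  apply: (irreducible_lyap irr pS lS).
    by rewrite adjmxN !adjmxM adjmxK hX mulmxA.
  by rewrite lyapN -(lyap_intertwine _ VB VD); apply: psdN_congr.
by split=> //; apply: psdN_congr0; rewrite // (lyap_intertwine _ VB VD).
Qed.

(** Put [T = V X^2] and [Q = T X^-1 T^H].  By [intertwining_defect],
    [lyap b d Q] is the sum of the form of [X^-1] at [T D - d T] and of a
    semidefinite term, so it is zero by irreducibility, and both summands
    vanish. *)
Lemma intertwiner_mul_sqr r n (V : 'M[C]_(r, n)) (B D X : 'M[C]_n)
    (b d S : 'M[C]_r) :
  irreducible_pair b d -> pd S -> lyap b d S = 0 ->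
  pd X -> psd (- lyap B D X) -> psd (- lyap B D (invmx X)) ->
  V *m B = b *m V -> V *m D = d *m V ->
  V *m (X *m X) *m B = b *m (V *m (X *m X)) /\
  V *m (X *m X) *m D = d *m (V *m (X *m X)).
Proof.
move=> irr pS lS pX nX nXi VB VD.
have hX := pX.1; have uX := pd_unit pX; have [hXi _] := pd_inv pX.
have [_ VLX] := irreducible_intertwiner irr pS lS hX nX VB VD.
set T := V *m (X *m X).
have E1 : b *m V *m X + V *m X *m B^H + d *m V *m X *m D^H = 0.
  by rewrite -VB -VD -VLX /lyap !mulmxDr !mulmxA.
have TXi : T *m invmx X = V *m X by rewrite /T mulmxA mulmxK.
have TE : T = V *m (X *m X) by [].
clearbody T.
have E0 : b *m (T *m invmx X) + T *m invmx X *m B^H +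
    d *m (T *m invmx X) *m D^H = 0 by rewrite TXi !mulmxA.
have E := intertwining_defect hXi E0; set G := T *m D - d *m T in E.
pose Q := T *m invmx X *m T^H.
have pG : psd (G *m invmx X *m G^H).
  exact: psd_congr (pd_psd (pd_inv pX)).
have nT : psd (- (T *m lyap B D (invmx X) *m T^H)) by apply: psdN_congr.
have lQ : lyap b d Q = 0.
  apply: (irreducible_lyap irr pS lS).
    exact: (psd_congr T (pd_psd (pd_inv pX))).1.
  rewrite -[lyap _ _ _](addrK (T *m lyap B D (invmx X) *m T^H)).
  by rewrite -E; apply: psdD.
rewrite lQ add0r in E.
have G0 : G *m invmx X *m G^H = 0 by apply: psd_anti => //; rewrite E.
have TD : T *m D = d *m T.
  by apply/eqP; rewrite -subr_eq0; apply/eqP; apply: pd_congr0 (pd_inv pX) G0.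
split=> //.
have : T *m lyap B D (invmx X) = 0 by apply: psdN_congr0; rewrite // -E G0.
(* Both [T (lyap B D X^-1) = 0] and [E1] express [V X B^H]; comparing them
   gives [T B X^-1 = b V X]. *)
rewrite /lyap !mulmxDr !mulmxA TXi TD -(mulmxA d T) TXi mulmxA -{1}E1.
move/addIr/addIr/(congr1 (mulmx^~ X)); rewrite mulmxKV // => ->.
by rewrite TE !mulmxA.
Qed.

(** The intertwiners of [B], [D] with an irreducible pair form a space stable
    under multiplication by [X^2]; an eigenvector for that multiplication is one
    for multiplication by [X], as [X] is positive definite. *)
Lemma ex_eigen_intertwiner n (B D X Y : 'M[C]_n) a : pd X ->
  psd (- lyap B D X) -> psd (- lyap B D (invmx X)) ->
  Y != 0 -> 0 <= a + a^* -> lyap B D Y = a *: Y ->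
  exists r (V : 'M[C]_(r, n)) (b d : 'M[C]_r) s,
    [/\ V != 0, row_free V, V *m B = b *m V & V *m D = d *m V] /\
    [/\ 0 < s, V *m X = s *: V & lyap b d (V *m V^H) = 0].
Proof.
move=> pX nX nXi Y0 a_ge0 LY.
have [r [U [b [d [[r0 fU UB UD UL] irr]]]]] :=
  ex_null_intertwiner pX nX Y0 a_ge0 LY.
pose S := U *m X *m U^H; have pS : pd S := pd_congr fU pX.
have lS : lyap b d S = 0 by rewrite -(lyap_intertwine _ UB UD) UL mul0mx.
pose P (V : 'M[C]_(r, n)) := V *m B = b *m V /\ V *m D = d *m V.
have stP V t : P V -> P (V *m (X *m X) - t *: V).
  move=> [VB VD].
  have [TB TD] := intertwiner_mul_sqr irr pS lS pX nX nXi VB VD.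
  by split; rewrite mulmxBl mulmxBr -scalemxAl -scalemxAr ?VB ?VD ?TB ?TD.
have U0 : U != 0.
  by apply/eqP => U0; move: fU r0; rewrite U0 /row_free mxrank0 => /eqP <-.
have [V [t [V0 [VB VD]]]] := eigenvector_invariant stP U0 (conj UB UD).
rewrite mulmxA => Vt; have [t_gt0 VX] := pd_sqr_eigen pX V0 Vt.
have s_gt0 : 0 < sqrtC t by rewrite sqrtC_gt0.
(* The left kernel of [V] is invariant under [b] and [d], hence zero. *)
have fV : row_free V.
  by apply: irr => //; rewrite -mulmxA -?VB -?VD mulmxA mulmx_ker mul0mx.
exists r, V, b, d, (sqrtC t); split=> //; split=> //.
have [+ _] := irreducible_intertwiner irr pS lS pX.1 nX VB VD.
rewrite VX -scalemxAl lyapZ => /eqP.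
by rewrite scaler_eq0 gt_eqF //= => /eqP.
Qed.

End Lyapunov.

(** * Extending an invariant subspace of the truncated system *)

Section Truncation.
Variable C : numClosedFieldType.

(** The form of the Lyapunov matrix at [[V, 0]] reduces to that of [Z] at
    [V D12]; being nonpositive, it is zero.  Then [[V, 0]] is killed by the
    Lyapunov matrix, and the second block of this relation is the last
    equation. *)
Lemma lyap_offdiag r n1 n2 (V : 'M[C]_(r, n1)) (b d : 'M[C]_r)
    (B11 D11 X : 'M[C]_n1) (B12 D12 : 'M[C]_(n1, n2))
    (B21 D21 : 'M[C]_(n2, n1)) (B22 D22 Z : 'M[C]_n2) s :
  pd Z -> psd (- lyap (block_mx B11 B12 B21 B22) (block_mx D11 D12 D21 D22)
    (block_mx X 0 0 Z)) ->
  V *m B11 = b *m V -> V *m D11 = d *m V -> V *m X = s *: V ->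
  lyap b d (V *m V^H) = 0 ->
  V *m D12 = 0 /\
  V *m B12 *m Z = - s *: (V *m B21^H + d *m V *m D21^H).
Proof.
move=> pZ nL VB VD VX lV.
set L := lyap _ _ _ in nL; pose W : 'M[C]_(r, n1 + n2) := row_mx V 0.
have WL : W *m L = row_mx
    (V *m lyap B11 D11 X + V *m D12 *m Z *m D12^H)
    (V *m (B12 *m Z + X *m B21^H + D11 *m X *m D21^H) + V *m D12 *m Z *m D22^H).
  rewrite /W /L /lyap !adjmx_block !mulmx_block !add_block_mx mul_row_block.
  rewrite !(mul0mx, mulmx0, addr0, add0r) !mulmxDr !mulmxA.
  by congr row_mx; rewrite !addrA.
have WLW : W *m L *m W^H = V *m D12 *m Z *m (V *m D12)^H.
  rewrite WL /W adjmx_row adjmx0 mul_row_col mulmx0 addr0 mulmxDl.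
  rewrite (lyap_intertwine _ VB VD) VX -scalemxAl lyapZ lV scaler0 add0r.
  by rewrite adjmxM !mulmxA.
have VDZ : V *m D12 *m Z *m (V *m D12)^H = 0.
  apply: psd_anti; first exact: psd_congr (pd_psd pZ).
  by rewrite -WLW; apply: psdN_congr.
have VD12 := pd_congr0 pZ VDZ; split=> //.
have : W *m L = 0 by apply: psdN_congr0; rewrite // WLW.
rewrite WL -row_mx0 => /eq_row_mx[_].
rewrite VD12 !mul0mx addr0 !mulmxDr !mulmxA VD VX -(mulmxA d V) VX -addrA.
rewrite -scalemxAr -!scalemxAl -scalerDr => /eqP.
by rewrite addr_eq0 scaleNr => /eqP.
Qed.

(** If [lyap B D] were bijective, then so would be [lyap b d]: each matrix
    is [U M U^H] for some [M], and
    [U (lyap B D Y) U^H = lyap b d (U Y U^H)]. *)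
Lemma lyap_singular r n (U : 'M[C]_(r, n)) B D b d P : row_free U ->
  U *m B = b *m U -> U *m D = d *m U -> P != 0 -> lyap b d P = 0 ->
  exists2 Y, Y != 0 & lyap B D Y = 0.
Proof.
move=> fU UB UD P0 lP.
have linL k (b' d' : 'M[C]_k) : linear (lyap b' d').
  by move=> a X Y; rewrite lyapD lyapZ.
pose fL k (b' d' : 'M[C]_k) : {linear 'M[C]_k -> 'M[C]_k} :=
  HB.pack (lyap b' d') (GRing.isLinear.Build _ _ _ _ _ (linL k b' d')).
pose M := lin_mx (fL _ B D); pose m := lin_mx (fL _ b d).
have ME Y : mxvec Y *m M = mxvec (lyap B D Y) by rewrite mul_vec_lin.
have mE Y : mxvec Y *m m = mxvec (lyap b d Y) by rewrite mul_vec_lin.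
have [kM|kM] := eqVneq (kermx M) 0; last first.
  pose k := nz_row (kermx M); have k0 : k != 0 by rewrite nz_row_eq0.
  have kM0 : k *m M = 0 by apply/eqP; rewrite -sub_kermx nz_row_sub.
  exists (vec_mx k).
    by apply: contra k0 => /eqP e; rewrite -[k]vec_mxK e linear0.
  by apply: (can_inj mxvecK); rewrite -ME vec_mxK kM0 linear0.
case/negP: P0; apply/eqP/(can_inj mxvecK); rewrite linear0.
have uM : M \in unitmx by rewrite -row_free_unit -kermx_eq0 kM.
suff um : m \in unitmx by rewrite -[mxvec P](mulmxK um) mE lP linear0 mul0mx.
rewrite -row_full_unit -sub1mx; apply/row_subP => i; set w := row i _.
have [U' UU'] : exists U' : 'M[C]_(n, r), U *m U' = 1%:M.
  by have /row_freeP[U' ?] := fU; exists U'.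
pose Y := vec_mx (mxvec (U' *m vec_mx w *m U'^H) *m invmx M).
suff -> : w = mxvec (U *m Y *m U^H) *m m by apply: submxMl.
rewrite mE -(lyap_intertwine _ UB UD).
have -> : lyap B D Y = U' *m vec_mx w *m U'^H.
  by apply: (can_inj mxvecK); rewrite -ME vec_mxK mulmxKV.
rewrite !mulmxA UU' mul1mx -mulmxA -adjmxM UU' adjmx_scalar conjC1 mulmx1.
by rewrite vec_mxK.
Qed.

Lemma eigenvalue_rows m n (X : 'M[C]_n) (V : 'M[C]_(m, n)) s :
  V != 0 -> V *m X = s *: V -> eigenvalue X s.
Proof.
move=> V0 /eigenspaceP VX; apply: contra V0 => /eqP e.
by rewrite e submx0 in VX.
Qed.

(** The subspace of [ex_eigen_intertwiner], extended by zero, is invariant under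
    [B] and [D]: [lyap_offdiag] for [X], [Z], [s] and for their inverses gives
    [V D12 = 0] and two expressions for [V B12], which force [V B12 = 0]. *)
Lemma truncation_null n1 n2 (B11 D11 X : 'M[C]_n1) (B12 D12 : 'M[C]_(n1, n2))
    (B21 D21 : 'M[C]_(n2, n1)) (B22 D22 Z : 'M[C]_n2) (Y : 'M[C]_n1) a
    (B := block_mx B11 B12 B21 B22) (D := block_mx D11 D12 D21 D22) :
  pd X -> pd Z -> (forall s, ~~ (eigenvalue X s && eigenvalue Z s)) ->
  psd (- lyap B D (block_mx X 0 0 Z)) ->
  psd (- lyap B D (block_mx (invmx X) 0 0 (invmx Z))) ->
  Y != 0 -> 0 <= a + a^* -> lyap B11 D11 Y = a *: Y ->
  exists2 Y', Y' != 0 & lyap B D Y' = 0.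
Proof.
move=> pX pZ dis nL nLi Y0 a0 LY.
have nL1 X' Z' : pd Z' -> psd (- lyap B D (block_mx X' 0 0 Z')) ->
    psd (- lyap B11 D11 X').
  move=> pZ' nL'; pose E : 'M[C]_(n1, n1 + n2) := row_mx 1%:M 0.
  have EE : E *m lyap B D (block_mx X' 0 0 Z') *m E^H =
      lyap B11 D11 X' + D12 *m Z' *m D12^H.
    rewrite /E /lyap !adjmx_block adjmx_row adjmx_scalar conjC1 adjmx0.
    rewrite !mulmx_block !add_block_mx mul_row_block mul_row_col.
    by rewrite !(mul0mx, mulmx0, mul1mx, mulmx1, addr0, add0r) !addrA.
  rewrite -[lyap B11 _ _](addrK (D12 *m Z' *m D12^H)) -EE opprD opprK.
  apply: psdD; last exact: psd_congr (pd_psd pZ').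
  exact: psdN_congr.
have [r [V [b [d [s [[V0 fV VB VD] [s0 VX lV]]]]]]] :=
  ex_eigen_intertwiner pX (nL1 _ _ pZ nL) (nL1 _ _ (pd_inv pZ) nLi) Y0 a0 LY.
have s_neq0 : s != 0 by rewrite gt_eqF.
have VXi : V *m invmx X = s^-1 *: V.
  rewrite -[V in LHS](scalerK s_neq0) -VX -!scalemxAl mulmxK ?pd_unit //.
have [VD12 VB12] := lyap_offdiag pZ nL VB VD VX lV.
have [_ VB12i] := lyap_offdiag (pd_inv pZ) nLi VB VD VXi lV.
set W := (_ + _) in VB12 VB12i; set T := V *m B12 in VB12 VB12i.
(* Eliminate the common sum [W] from the two expressions for [V B12]. *)
have TZZ : T *m Z *m Z = s ^+ 2 *: T.
  rewrite -[T in RHS](mulmxKV (pd_unit pZ)) VB12i VB12 -!scalemxAl scalerA.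
  by congr (_ *: _); field.
have T0 : V *m B12 = 0.
  rewrite -/T; have [//|T0] := eqVneq T 0.
  have [_] := pd_sqr_eigen pZ T0 TZZ; rewrite sqrCK ?ltW // => TZ.
  case/negP: (dis s).
  by rewrite (eigenvalue_rows V0 VX) (eigenvalue_rows T0 TZ).
pose U : 'M[C]_(r, n1 + n2) := row_mx V 0.
have UB : U *m B = b *m U.
  by rewrite mul_row_block !mul0mx !addr0 T0 VB mul_mx_row mulmx0.
have UD : U *m D = d *m U.
  by rewrite mul_row_block !mul0mx !addr0 VD12 VD mul_mx_row mulmx0.
have fU : row_free U.
  by apply/row_freeP; have /row_freeP[V' VV'] := fV; exists (col_mx V' 0);
    rewrite mul_row_col mul0mx addr0.
apply: (lyap_singular fU UB UD _ lV).
apply: contra V0 => /eqP VV; apply/eqP; apply: (pd_congr0 (@pd1 C n1)).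
by rewrite mulmx1.
Qed.

End Truncation.

(** * Kronecker products and complexification *)

Section Kronecker.
Variable F : fieldType.

(** A row of length [n * n] is a square matrix [Y] read row by row, and
    multiplication by [M *t P] is then [Y |-> M^T Y P]. *)
Lemma eigenvalue_kron n (A N : 'M[F]_n) a :
  eigenvalue ((1%:M : 'M[F]_n) *t A + A *t (1%:M : 'M[F]_n) + N *t N) a <->
  exists2 Y, Y != 0 & A^T *m Y + Y *m A + N^T *m Y *m N = a *: Y.
Proof.
pose vec (Y : 'M[F]_n) : 'rV[F]_(n * n) :=
  \row_k Y (mxtens_unindex k).1 (mxtens_unindex k).2.
pose mat (v : 'rV[F]_(n * n)) : 'M[F]_n :=
  \matrix_(i, j) v 0 (mxtens_index (i, j)).
have vecK Y : mat (vec Y) = Y.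
  by apply/matrixP => i j; rewrite !mxE mxtens_indexK.
have matK v : vec (mat v) = v.
  by apply/rowP => k; rewrite !mxE -surjective_pairing mxtens_unindexK.
have vecM (M P Y : 'M[F]_n) : vec Y *m (M *t P) = vec (M^T *m Y *m P).
  apply/rowP => k; rewrite !mxE.
  rewrite (reindex (@mxtens_index n n)) /=; last first.
    by exists (@mxtens_unindex n n) => ? _; rewrite (mxtens_indexK, mxtens_unindexK).
  rewrite (eq_bigr (fun p : 'I_n * 'I_n =>
    M p.1 (mxtens_unindex k).1 * Y p.1 p.2 * P p.2 (mxtens_unindex k).2)); last first.
    by move=> p _; rewrite !mxE mxtens_indexK; ring.
  rewrite -(pair_bigA _ (fun i j =>
    M i (mxtens_unindex k).1 * Y i j * P j (mxtens_unindex k).2)) exchange_big /=.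
  apply: eq_bigr => j _; rewrite mxE big_distrl /=.
  by apply: eq_bigr => i _; rewrite mxE.
have vecD Y Y' : vec Y + vec Y' = vec (Y + Y').
  by apply/rowP => k; rewrite !mxE.
have vecZ c Y : c *: vec Y = vec (c *: Y) by apply/rowP => k; rewrite !mxE.
have vec0 Y : (vec Y == 0) = (Y == 0).
  have v0 : vec 0 = 0 by apply/rowP => k; rewrite !mxE.
  by rewrite -{1}v0; apply/eqP/eqP => [/(congr1 mat)|->//]; rewrite !vecK.
have vecL Y : vec Y *m (1%:M *t A + A *t 1%:M + N *t N) =
    vec (A^T *m Y + Y *m A + N^T *m Y *m N).
  by rewrite !mulmxDr !vecM !vecD trmx1 mul1mx mulmx1 [X in X + _]addrC.
split=> [/eigenvalueP[v vE v0]|[Y Y0 YE]].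
  exists (mat v); first by rewrite -vec0 matK.
  by apply: (can_inj vecK); rewrite -vecL -vecZ matK.
by apply/eigenvalueP; exists (vec Y); rewrite ?vec0 // vecL YE vecZ.
Qed.
End Kronecker.

Local Notation cmx := (map_mx (real_complex _)).

Section Complexification.
Variable R : realType.

Lemma adjmx_complexify m n (M : 'M[R]_(m, n)) : (cmx M)^H = cmx M^T.
Proof.
by apply/matrixP => i j; rewrite !mxE; apply: (conjc_real (M j i)).
Qed.

(** The imaginary parts cancel because [M] is symmetric. *)
Lemma qform_complexify n (M : 'M[R]_n) (u : 'rV[R[i]]_n) : M^T = M ->
  let x := map_mx (@complex.Re R) u in let y := map_mx (@complex.Im R) u in
  qform (cmx M) u =
  ((x *m M *m x^T) 0 0 + (y *m M *m y^T) 0 0)%:C%C.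
Proof.
move=> sM x y; have uE : u = cmx x + 'i%C *: cmx y.
  by apply/rowP => k; rewrite !mxE [LHS]complexE.
have uH : u^H = cmx x^T - 'i%C *: cmx y^T.
  rewrite [in LHS]uE adjmxD adjmxZ !adjmx_complexify -scaleNr; congr (_ + _ *: _).
  by apply/eqP; rewrite eq_complex /= oppr0 !eqxx.
have yx : y *m M *m x^T = (x *m M *m y^T).
  have -> : y *m M *m x^T = (x *m M *m y^T)^T.
    by rewrite !trmx_mul trmxK sM mulmxA.
  by apply/matrixP=> i j; rewrite mxE !ord1.
rewrite /qform uH {1}uE mulmxDl !mulmxBr !mulmxDl -!scalemxAl -!scalemxAr.
rewrite -!map_mxM yx scalerA -expr2 sqr_i scaleN1r opprD opprK addrA addrK.
by rewrite rmorphD !mxE.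
Qed.

Lemma pd_complexify n (M : 'M[R]_n) : posdefmx M -> pd (cmx M).
Proof.
move=> [sM pM]; split; first by rewrite adjmx_complexify sM.
have pM0 (x : 'rV[R]_n) : 0 <= (x *m M *m x^T) 0 0 ?= iff (x == 0).
  have [->|x0] := eqVneq x 0; first by rewrite !mul0mx mxE; split; rewrite ?eqxx.
  have : 0 < (x *m M *m x^T) 0 0.
    by rewrite -{1}[x]trmxK; apply: pM; rewrite trmx_eq0.
  by move=> gt0; split; rewrite ?ltW // lt_eqF.
move=> u u0; rewrite qform_complexify // (ltcR 0) lt_neqAle.
rewrite addr_ge0 ?pM0 // andbT eq_sym paddr_eq0 ?pM0 //.
rewrite ![_ == 0]eq_sym !pM0; apply: contra u0 => /andP[/eqP x0 /eqP y0].
apply/eqP/rowP => k; rewrite [LHS]complexE.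
have /rowP/(_ k) := x0; have /rowP/(_ k) := y0; rewrite !mxE => -> ->.
by rewrite rmorph0 mulr0 addr0.
Qed.

Lemma psd_complexify n (M : 'M[R]_n) : possemidefmx M -> psd (cmx M).
Proof.
move=> [sM pM]; split; first by rewrite adjmx_complexify sM.
move=> u; rewrite qform_complexify // ler0c.
by rewrite addr_ge0 // -{1}[map_mx _ u]trmxK; apply: pM.
Qed.
End Complexification.

Lemma lyap_complexify (R : realType) n (A N X : 'M[R]_n) :
  lyap (cmx A^T) (cmx N^T) (cmx X) =
  cmx (A^T *m X + X *m A + N^T *m X *m N).
Proof. by rewrite /lyap !adjmx_complexify !trmxK !map_mxD !map_mxM. Qed.

Lemma mem_spectrum_kron (R : realType) n (A N : 'M[R]_n) z :
  z \in spectrum (kron_lyapunov A N) <->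
  exists2 Y, Y != 0 & lyap (cmx A^T) (cmx N^T) Y = z *: Y.
Proof.
rewrite /lyap !adjmx_complexify !trmxK -!map_trmx -eigenvalue_kron.
by rewrite /kron_lyapunov unfold_in /spectrum !map_mxD !map_mxT !map_mx1.
Qed.

Unset Implicit Arguments.

Theorem mainTheorem1 (R : realType) (n1 n2 : nat)
    (A N : 'M[R]_(n1 + n2))
    (A11 : 'M[R]_n1) (A12 : 'M[R]_(n1, n2))
    (A21 : 'M[R]_(n2, n1)) (A22 : 'M[R]_n2)
    (N11 : 'M[R]_n1) (N12 : 'M[R]_(n1, n2))
    (N21 : 'M[R]_(n2, n1)) (N22 : 'M[R]_n2)
    (Sigma : 'M[R]_(n1 + n2)) (Sigma1 : 'M[R]_n1) (Sigma2 : 'M[R]_n2)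
    (defA : A = block_mx A11 A12 A21 A22)
    (defN : N = block_mx N11 N12 N21 N22)
    (defSigma : Sigma = block_mx Sigma1 0 0 Sigma2)
    (stableAN :
      {subset spectrum (kron_lyapunov A N) <= open_left_half_plane R})
    (Sigma_gt0 : posdefmx Sigma)
    (disjoint_spectra :
      forall z : R[i], ~ (z \in spectrum Sigma1 /\ z \in spectrum Sigma2))
    (lyap_Sigma :
      lemx (A^T *m Sigma + Sigma *m A + N^T *m Sigma *m N) 0)
    (lyap_invSigma :
      lemx (A^T *m invmx Sigma + invmx Sigma *m A
            + N^T *m invmx Sigma *m N) 0) :
  {subset spectrum (kron_lyapunov A11 N11) <= open_left_half_plane R}.
Proof.
move=> z /mem_spectrum_kron[Y Y0 LY]; rewrite unfold_in /open_left_half_plane.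
rewrite ltNge; apply/negP => z_ge0.
have cSigma : cmx Sigma = block_mx (cmx Sigma1) 0 0 (cmx Sigma2).
  by rewrite defSigma map_block_mx !map_mx0.
have pS := pd_complexify Sigma_gt0; rewrite cSigma in pS.
have [pS1 pS2] := pd_block_inv pS.
have cSigmai : cmx (invmx Sigma) =
    block_mx (invmx (cmx Sigma1)) 0 0 (invmx (cmx Sigma2)).
  rewrite map_invmx cSigma.
  have uS := pd_unit pS; apply: (can_inj (mulKmx uS)).
  rewrite mulmxV // mulmx_block !(mul0mx, mulmx0, addr0, add0r).
  by rewrite !mulmxV ?pd_unit // -scalar_mx_block.
have nL := psd_complexify lyap_Sigma.
have nLi := psd_complexify lyap_invSigma.
have tA : cmx A^T = block_mx (cmx A11^T) (cmx A21^T)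
                         (cmx A12^T) (cmx A22^T).
  by rewrite defA tr_block_mx map_block_mx.
have tN : cmx N^T = block_mx (cmx N11^T) (cmx N21^T)
                         (cmx N12^T) (cmx N22^T).
  by rewrite defN tr_block_mx map_block_mx.
rewrite !sub0r map_mxN -lyap_complexify ?cSigma tA tN in nL.
rewrite !sub0r map_mxN -lyap_complexify ?cSigmai tA tN in nLi.
have dis s : ~~ (eigenvalue (cmx Sigma1) s && eigenvalue (cmx Sigma2) s).
  by apply/negP => /andP; apply: disjoint_spectra.
have [|Y' Y'0 LY'] := truncation_null pS1 pS2 dis nL nLi Y0 _ LY.
  by rewrite (addcJ z) mulr_ge0 // (ler0c (complex.Re z)).
rewrite -tA -tN in LY'.
have : 0 \in spectrum (kron_lyapunov A N).
  by apply/mem_spectrum_kron; exists Y' => //; rewrite scale0r.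
by move/stableAN; rewrite unfold_in /open_left_half_plane ltxx.
Qed.
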